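(* For all integers $m,p\geq 1$ and $q\geq 2$, the number $$(-1)^{m-1}\sum_{\substack{i+j=p-1\\ i,j\geq 0}}\binom{m+i-1}{i}\binom{q+j-1}{j}T_{m+i,q+j}+(-1)^{p-1}\sum_{\substack{i+j=m-1\\ i,j\geq 0}}\binom{p+i-1}{i}\binom{q+j-1}{j}\tilde S_{p+i,q+j}$$ lies in $\mathbb{Q}[\ln(2),\text{zeta values}]$. In particular, it is equal to $$\begin{aligned}&(-1)^{m}\sum_{\substack{i+j=p-1\\ i,j\geq 0}}\binom{m+i-1}{i}\binom{q+j-1}{j}(-1)^{m+i}\,\tilde t(m+i)\,\tilde t(q+j)\\&+(-1)^{p}\sum_{\substack{i+j=m-1\\ i,j\geq 0}}\binom{p+i-1}{i}\binom{q+j-1}{j}(-1)^{p+i}\,\tilde t(p+i)\,\zeta(q+j)\\&-\sum_{\substack{i+j=q-1\\ i,j\geq 0}}\binom{m+i-1}{i}\binom{p+j-1}{j}\,\zeta(m+i)\,\tilde t(p+j),\end{aligned}$$ where, by convention, $\zeta(1):=-2\ln(2)$ and $\tilde t(1):=0$ wherever they occur.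
   Context: For integers $n\ge 0$, $r\geq 1$: $h_0^{(r)}=0$ and $h_n^{(r)}=\sum_{k=1}^n\frac{1}{(k-1/2)^r}$. For integers $p\geq 1$, $q\geq 2$: $T_{p,q}=\sum_{n=1}^\infty\frac{h_{n-1}^{(p)}}{(n-1/2)^q}$ and $\tilde S_{p,q}=\sum_{n=1}^\infty\frac{h_n^{(p)}}{n^q}$. For integers $s\geq 2$: $\zeta(s)=\sum_{n\geq1}n^{-s}$ is the Riemann zeta value and $\tilde t(s)=\sum_{n=1}^\infty\frac{1}{(n-1/2)^s}=(2^s-1)\zeta(s)$. $\mathbb{Q}[\ln(2),\text{zeta values}]$ denotes the $\mathbb{Q}$-subalgebra of $\mathbb{R}$ generated by $\ln 2$ and the numbers $\zeta(k)$, $k\geq 2$ an integer. *)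

(* Defs.v *)
From mathcomp Require Import all_boot all_order all_algebra.
From mathcomp Require Import all_classical all_reals all_analysis.

Set Implicit Arguments.
Unset Strict Implicit.
Unset Printing Implicit Defensive.

Import Order.TTheory GRing.Theory Num.Theory.
Import numFieldNormedType.Exports.

Local Open Scope classical_set_scope.
Local Open Scope ring_scope.

Section Defs.
Variable R : realType.

Definition h (r n : nat) : R :=
  \sum_(1 <= k < n.+1) ((k%:R - 1 / 2) ^+ r)^-1.

(* The sum over n >= 1 of u n; only meaningful when the series converges. *)
Definition sum_ge1 (u : nat -> R) : R :=
  limn (fun N => \sum_(1 <= n < N) u n).

Definition T (p q : nat) : R :=
  sum_ge1 (fun n => h p (n - 1) / (n%:R - 1 / 2) ^+ q).

Definition S_tilde (p q : nat) : R :=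
  sum_ge1 (fun n => h p n / n%:R ^+ q).

Definition zeta (s : nat) : R :=
  sum_ge1 (fun n => (n%:R ^+ s)^-1).

Definition t_tilde (s : nat) : R :=
  sum_ge1 (fun n => ((n%:R - 1 / 2) ^+ s)^-1).

(* Conventional values at s = 1, where the series diverge. *)

Definition zeta_conv (s : nat) : R :=
  if s == 1%N then - 2 * ln 2 else zeta s.

Definition t_conv (s : nat) : R :=
  if s == 1%N then 0 else t_tilde s.

(* The sum of F i j over all i, j >= 0 with i + j = n. *)
Definition sum_antidiag (n : nat) (F : nat -> nat -> R) : R :=
  \sum_(ij : 'I_n.+1 * 'I_n.+1 | (ij.1 + ij.2)%N == n) F ij.1 ij.2.

(* This is GRing.subalg_closed for scalars in rat acting through ratr, since
   a realType carries no canonical rat-algebra structure. *)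
Definition rat_subalgebra (A : set R) : Prop :=
  [/\ A 1,
      forall (a : rat) (x y : R), A x -> A y -> A (ratr a * x + y)
    & forall x y : R, A x -> A y -> A (x * y)].

Definition Q_ln2_zeta : set R :=
  smallest rat_subalgebra
    ([set ln 2] `|` [set zeta k | k in [set k : nat | (2 <= k)%N]]).

End Defs.

(* Main.v *)
Require Import Defs.
From mathcomp Require Import all_boot all_order all_algebra.
From mathcomp Require Import all_classical all_reals all_analysis.
From mathcomp Require Import ring lra zify.

Set Implicit Arguments.
Unset Strict Implicit.
Unset Printing Implicit Defensive.

Import Order.TTheory GRing.Theory Num.Theory.
Import numFieldNormedType.Exports.

Local Open Scope classical_set_scope.
Local Open Scope ring_scope.

(** The identity is the residue theorem for
    F(s) = Phi(s) Psi(s) / s ^ q,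
with Phi(s) the sum over k >= 1 of (s - k) ^ (- m) and Psi(s) the sum over l >=
1 of (s - (l - 1/2)) ^ (- p). At the half-integer l - 1/2 the Taylor
coefficient of Phi of degree i is, up to sign and a binomial factor, h_(l-1) +
(-1) ^ r t~(r) with exponent r = m + i on both terms, since the differences of
half-integers and integers are half-integers of both signs; hence the residues
there sum to the T-part of the theorem together with products t~ t~. Likewise
the residues at the integers k give the S~-part with products t~ zeta, and the
residue at 0 gives the products zeta t~.

No complex analysis is used. Both sums are truncated at N, so that F is a
rational function and the vanishing of its total residue is an algebraic
identity ([residue_sum_family]). It is additive in the poles, so it reduces to
the case of one pole a and one pole b besides 0 ([residue_sum_eq0]), which
follows by induction on the orders of the poles.

When m = 1 or p = 1 the sum Phi or Psi diverges, and the constant h_N is added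
to the truncated sum. A constant does not disturb the residue theorem because q
>= 2, and in the limit it produces the conventions: h_N - h_N = 0 gives t~(1) =
0, while h_N - (1 + 1/2 + ... + 1/N) -> 2 ln 2 gives zeta(1) = - 2 ln 2
([cvg_h1_sub_zeta_sum1]).

The limit N -> oo ([cvg_weighted_sum]) is an instance of dominated convergence
([tannery0]): the truncation replaces t~ at the l-th pole by h_(N-d) with d = l
or d = l - 1, and 0 <= h_N - h_(N-d) <= h_d, where h_l / l ^ 2 is summable.

Membership in the algebra then follows from t~(s) = (2 ^ s - 1) zeta(s)
([t_tilde_zeta]). *)

(** * Residues of a rational function with two families of poles *)

Section Residues.
Variable F : fieldType.

Definition cauchy_prod (n : nat) (f g : nat -> F) : F :=
  \sum_(i < n.+1) f i * g (n - i)%N.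

(** Sequences stand for formal power series; this is multiplication by the
    variable, and [kronecker0] is the series 1. *)
Definition mulX (f : nat -> F) (n : nat) : F := if n is n'.+1 then f n' else 0.

Definition kronecker0 (n : nat) : F := (n == 0%N)%:R.

Lemma cauchy_prod_mulXl n f g :
  cauchy_prod n (mulX f) g = mulX (fun k => cauchy_prod k f g) n.
Proof.
by case: n => [|n]; rewrite /cauchy_prod big_ord_recl /= mul0r ?big_ord0 add0r.
Qed.

Lemma cauchy_prod_mulXr n f g :
  cauchy_prod n f (mulX g) = mulX (fun k => cauchy_prod k f g) n.
Proof.
case: n => [|n]; rewrite /cauchy_prod big_ord_recr /= ?subnn mulr0 ?big_ord0
  addr0 //.
by apply: eq_bigr => i _ /=; rewrite subSn // -ltnS.
Qed.

Lemma cauchy_prod_kroneckerl n g : cauchy_prod n kronecker0 g = g n.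
Proof.
rewrite /cauchy_prod big_ord_recl mul1r subn0 big1 ?addr0 // => i _.
by rewrite /kronecker0 /= mul0r.
Qed.

Lemma cauchy_prod_kroneckerr n f : cauchy_prod n f kronecker0 = f n.
Proof.
rewrite /cauchy_prod big_ord_recr /= subnn /kronecker0 eqxx mulr1.
rewrite big1 ?add0r // => i _.
by rewrite subn_eq0 leqNgt ltn_ord mulr0.
Qed.

Lemma eq_cauchy_prod n f f' g g' :
  f =1 f' -> g =1 g' -> cauchy_prod n f g = cauchy_prod n f' g'.
Proof. by move=> ff gg; apply: eq_bigr => i _; rewrite ff gg. Qed.

Lemma cauchy_prodDl n f f' g :
  cauchy_prod n (fun i => f i + f' i) g
  = cauchy_prod n f g + cauchy_prod n f' g.
Proof. by rewrite -big_split; apply: eq_bigr => i _; rewrite mulrDl. Qed.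

Lemma cauchy_prodDr n f g g' :
  cauchy_prod n f (fun i => g i + g' i)
  = cauchy_prod n f g + cauchy_prod n f g'.
Proof. by rewrite -big_split; apply: eq_bigr => i _; rewrite mulrDr. Qed.

Lemma cauchy_prodZl n c f g :
  cauchy_prod n (fun i => c * f i) g = c * cauchy_prod n f g.
Proof. by rewrite mulr_sumr; apply: eq_bigr => i _; rewrite mulrA. Qed.

Lemma cauchy_prodZr n c f g :
  cauchy_prod n f (fun i => c * g i) = c * cauchy_prod n f g.
Proof. by rewrite mulr_sumr; apply: eq_bigr => i _; rewrite mulrCA. Qed.

Lemma cauchy_prod_suml n (I : Type) (r : seq I) (f : I -> nat -> F) g :
  cauchy_prod n (fun i => \sum_(k <- r) f k i) g
  = \sum_(k <- r) cauchy_prod n (f k) g.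
Proof. by rewrite exchange_big; apply: eq_bigr => i _; rewrite mulr_suml. Qed.

Lemma cauchy_prod_sumr n (I : Type) (r : seq I) f (g : I -> nat -> F) :
  cauchy_prod n f (fun i => \sum_(k <- r) g k i)
  = \sum_(k <- r) cauchy_prod n f (g k).
Proof. by rewrite exchange_big; apply: eq_bigr => i _; rewrite mulr_sumr. Qed.

(** The Taylor coefficient of t ^ i in (x - t) ^ (- m). *)
Definition pole_coef (x : F) (m i : nat) : F :=
  'C(m + i - 1, i)%:R / x ^+ (m + i).

Lemma pole_coef0 x : pole_coef x 0 =1 kronecker0.
Proof.
move=> [|i]; rewrite /pole_coef /kronecker0 /= ?expr0 ?divr1 //.
by rewrite bin_small ?mul0r // add0n subn1.
Qed.

(** Read off from (x - t) (x - t) ^ (- m - 1) = (x - t) ^ (- m); the case i > 0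
    is Pascal's rule. *)
Lemma pole_coefS x m i : x != 0 ->
  x * pole_coef x m.+1 i = pole_coef x m i + mulX (pole_coef x m.+1) i.
Proof.
move=> x0; case: i => [|i]; rewrite /pole_coef /=.
  by rewrite !addn0 !bin0 exprS addr0; field; rewrite expf_neq0 ?x0.
have -> : (m.+1 + i.+1 - 1 = (m + i).+1)%N by lia.
have -> : (m + i.+1 - 1 = m + i)%N by lia.
have -> : (m.+1 + i - 1 = m + i)%N by lia.
rewrite binS natrD !addSn addnS exprS.
by field; rewrite x0 expf_neq0.
Qed.

(** The sum of the residues at s = b, s = a and s = 0 of 1 / ((s - a) ^ m (s -
    b) ^ p s ^ (n + 1)). At a pole of order j + 1 the residue is the Taylor
    coefficient of degree j of the two other factors, computed with [pole_coef]
    in the variable - t, whence the signs (-1) ^ j; at s = 0 the sign (-1) ^ (m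
    + p) comes from s - a = - (a - s) and s - b = - (b - s). Wrapping in [mulX]
    sets the residue at b (at a) to zero when p = 0 (m = 0), that is when there
    is no pole. *)
Definition residue_sum (a b : F) (m p n : nat) : F :=
  mulX (fun j => (-1) ^+ j
     * cauchy_prod j (pole_coef (b - a) m) (pole_coef b n.+1)) p
  + mulX (fun j => (-1) ^+ j
     * cauchy_prod j (pole_coef (a - b) p) (pole_coef a n.+1)) m
  + (-1) ^+ (m + p) * cauchy_prod n (pole_coef a m) (pole_coef b p).

(** Multiplying the rational function by a - b = (s - b) - (s - a) lowers the
    order of one of the two poles; the residues at b, a and 0 satisfy this
    separately, up to terms that cancel, by [pole_coefS]. *)
Lemma residue_sum_rec a b m p n : a != 0 -> b != 0 -> a != b ->
  (a - b) * residue_sum a b m.+1 p.+1 n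
  = residue_sum a b m.+1 p n - residue_sum a b m p.+1 n.
Proof.
move=> a0 b0 ab.
have ab0 : a - b != 0 by rewrite subr_eq0.
have ba0 : b - a != 0 by rewrite subr_eq0 eq_sym.
have E (x : F) k j (g : nat -> F) : x != 0 ->
    x * cauchy_prod j (pole_coef x k.+1) g
    = cauchy_prod j (pole_coef x k) g
      + mulX (fun i => cauchy_prod i (pole_coef x k.+1) g) j.
  move=> x0; rewrite -cauchy_prodZl -cauchy_prod_mulXl -cauchy_prodDl.
  by apply: eq_cauchy_prod => // i; rewrite pole_coefS.
have Eb := E _ m p (pole_coef b n.+1) ba0.
have Ea := E _ p m (pole_coef a n.+1) ab0.
have E0 : (a - b) * cauchy_prod n (pole_coef a m.+1) (pole_coef b p.+1)
    = cauchy_prod n (pole_coef a m) (pole_coef b p.+1)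
      - cauchy_prod n (pole_coef a m.+1) (pole_coef b p).
  rewrite mulrBl (E a m n _ a0) -cauchy_prodZr.
  rewrite (@eq_cauchy_prod n _ (pole_coef a m.+1) _
    (fun i => pole_coef b p i + mulX (pole_coef b p.+1) i) _
    (fun i => pole_coefS _ _ b0)) //.
  by rewrite cauchy_prodDr cauchy_prod_mulXr; ring.
rewrite /residue_sum /= !addSn !addnS !exprS.
rewrite !mulrDr ![(a - b) * (-1 * _ * _)]mulrCA
  ![(a - b) * ((-1) ^+ _ * _)]mulrCA.
rewrite Ea E0 -(opprB b a) ![- (b - a) * _]mulNr Eb.
case: p m {E Ea Eb E0} => [|p] [|m] /=; rewrite ?exprS; ring.
Qed.

Lemma pole_coef_sym x m n : pole_coef x m.+1 n = pole_coef x n.+1 m.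
Proof.
rewrite /pole_coef !addSn !subn1 /= (addnC n); congr (_%:R / _).
by rewrite -bin_sub ?leq_addl // addnK.
Qed.

(** A rational function that decays at infinity like s ^ -2 or faster has total
    residue zero; m + p + n > 0 expresses this decay. The recurrence
    [residue_sum_rec] reduces the claim to functions with at most one pole
    besides s = 0, for which the two residues are opposite by the symmetry
    [pole_coef_sym]. *)
Lemma residue_sum_eq0 a b m p n : a != 0 -> b != 0 -> a != b ->
  (0 < m + p + n)%N -> residue_sum a b m p n = 0.
Proof.
move=> a0 b0 ab; elim: m p => [|m IHm] p.
  rewrite /residue_sum /= addr0.
  case: p => [|p] /= H.
    rewrite (eq_cauchy_prod n (pole_coef0 _) (pole_coef0 _))
      cauchy_prod_kroneckerl /kronecker0.
    by case: n H => // n _; rewrite mulr0 addr0.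
  rewrite !(eq_cauchy_prod _ (pole_coef0 _) (fun=> erefl))
    !cauchy_prod_kroneckerl.
  by rewrite pole_coef_sym exprS; ring.
elim: p => [|p IHp] H.
  rewrite /residue_sum /= add0r (eq_cauchy_prod _ (pole_coef0 _) (fun=> erefl)).
  rewrite (eq_cauchy_prod _ (fun=> erefl) (pole_coef0 _))
    cauchy_prod_kroneckerl cauchy_prod_kroneckerr.
  by rewrite pole_coef_sym addn0 exprS; ring.
have ab0 : a - b != 0 by rewrite subr_eq0.
apply: (mulfI ab0); rewrite residue_sum_rec // IHp ?IHm ?mulr0 ?subrr //; lia.
Qed.

(** Total residue zero for Phi(s) Psi(s) / s ^ (n + 2), where Phi(s) = c + sum
    over k of (s - a_k) ^ (- m - 1) and Psi(s) = d + sum over l of (s - b_l) ^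
    (- p - 1). The constants are allowed because the exponent n + 2 at 0 alone
    already provides the decay at infinity. *)
Lemma residue_sum_family (I J : eqType) (r : seq I) (s : seq J)
    (a : I -> F) (b : J -> F) (c d : F) (m p n : nat) :
  {in r, forall k, a k != 0} -> {in s, forall l, b l != 0} ->
  {in r & s, forall k l, a k != b l} ->
  (-1) ^+ p * (\sum_(l <- s) cauchy_prod p
      (fun i => \sum_(k <- r) pole_coef (b l - a k) m.+1 i + c * kronecker0 i)
      (pole_coef (b l) n.+2))
  + (-1) ^+ m * (\sum_(k <- r) cauchy_prod m
      (fun i => \sum_(l <- s) pole_coef (a k - b l) p.+1 i + d * kronecker0 i)
      (pole_coef (a k) n.+2))
  + cauchy_prod n.+1
      (fun i => (-1) ^+ m.+1 * \sum_(k <- r) pole_coef (a k) m.+1 i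
                + c * kronecker0 i)
      (fun j => (-1) ^+ p.+1 * \sum_(l <- s) pole_coef (b l) p.+1 j
                + d * kronecker0 j)
  = 0.
Proof.
move=> a0 b0 ab.
have H : \sum_(k <- r) \sum_(l <- s)
    residue_sum (a k) (b l) m.+1 p.+1 n.+1 = 0.
  rewrite big_seq big1 // => k kr; rewrite big_seq big1 // => l ls.
  by rewrite residue_sum_eq0 ?a0 ?b0 ?ab.
rewrite -[RHS]H {H}.
rewrite cauchy_prodDl !cauchy_prodDr !cauchy_prodZl !cauchy_prodZr
  !cauchy_prod_kroneckerl cauchy_prod_kroneckerr.
(* The function c d / s ^ (n + 2) has no residue. *)
have -> : kronecker0 n.+1 = 0 by [].
under eq_bigr do
  rewrite cauchy_prodDl cauchy_prod_suml cauchy_prodZl cauchy_prod_kroneckerl.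
under [X in _ + _ * X + _]eq_bigr do
  rewrite cauchy_prodDl cauchy_prod_suml cauchy_prodZl cauchy_prod_kroneckerl.
rewrite cauchy_prod_suml.
under [X in _ = X]eq_bigr do rewrite !big_split /= -!mulr_sumr.
under [X in _ * (_ * X)]eq_bigr do rewrite cauchy_prod_sumr.
rewrite !big_split /=.
have -> : \sum_(l <- s) c * pole_coef (b l) n.+2 p
    = c * \sum_(l <- s) pole_coef (b l) p.+1 n.+1.
  by rewrite mulr_sumr; apply: eq_bigr => l _; rewrite pole_coef_sym.
have -> : \sum_(k <- r) d * pole_coef (a k) n.+2 m
    = d * \sum_(k <- r) pole_coef (a k) m.+1 n.+1.
  by rewrite mulr_sumr; apply: eq_bigr => k _; rewrite pole_coef_sym.
(* Folded so that mulr_sumr does not factor the binomials out of the sums. *)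
set S1 := \sum_(l <- s) pole_coef (b l) p.+1 n.+1.
set S2 := \sum_(k <- r) pole_coef (a k) m.+1 n.+1.
rewrite exchange_big /= -!mulr_sumr.
set P1 := \sum_(k <- r) \sum_(l <- s)
  cauchy_prod p (pole_coef (b l - a k) m.+1) _.
set P2 := \sum_(k <- r) \sum_(l <- s)
  cauchy_prod m (pole_coef (a k - b l) p.+1) _.
set P3 := \sum_(k <- r) \sum_(l <- s)
  cauchy_prod n.+1 (pole_coef (a k) m.+1) (pole_coef (b l) p.+1).
rewrite addSn addnS !exprS exprD; ring.
Qed.
End Residues.

(** * Limits of half-integer and integer sums *)

Section Analysis.
Variable R : realType.

Definition subhalf (n : nat) : R := n%:R - 1 / 2.

Lemma subhalf_gt0 n : (0 < n)%N -> 0 < subhalf n.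
Proof.
by move=> n0; have : 1 <= n%:R :> R by [rewrite ler1n]; rewrite /subhalf; lra.
Qed.

Lemma subhalf_neq0 n : subhalf n != 0.
Proof.
case: n => [|n]; last by rewrite gt_eqF ?subhalf_gt0.
by rewrite /subhalf; apply/eqP; lra.
Qed.

Lemma le_subhalf n : (0 < n)%N -> n%:R <= 2 * subhalf n.
Proof.
by move=> n0; have : 1 <= n%:R :> R by [rewrite ler1n]; rewrite /subhalf; lra.
Qed.

Lemma natr_neq_subhalf k l : (k%:R : R) != subhalf l.
Proof.
apply/eqP => E; have : ((2 * k).+1 = 2 * l)%N; last lia.
apply/eqP; rewrite -(eqr_nat R) -natr1 !natrM E /subhalf; apply/eqP; lra.
Qed.

(** The points k - l + 1/2 are half-integers: those with l <= k run over 1/2,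
    3/2, ..., k - 1/2 and those with l > k over the opposites of the first N -
    k positive ones. *)
Lemma sum_inv_nat_sub_subhalf s N k : (k <= N)%N ->
  \sum_(1 <= l < N.+1) ((k%:R - subhalf l) ^+ s)^-1
  = h R s k + (-1) ^+ s * h R s (N - k).
Proof.
move=> kN; rewrite (@big_cat_nat _ _ _ k.+1) //=; congr (_ + _).
  rewrite big_nat_rev; apply: eq_big_nat => l /andP[l1 lk].
  congr ((_ ^+ s)^-1); rewrite /subhalf.
  have -> : (1 + k.+1 - l.+1 = k.+1 - l)%N by lia.
  rewrite (natrB _ (ltnW lk)) -natr1; lra.
rewrite -[k.+1]add1n big_addn mulr_sumr subSn //; apply: eq_bigr => l _.
rewrite -{1}[-1 : R]invrN1 exprVn -invfM -exprMn.
by congr ((_ ^+ s)^-1); rewrite /subhalf natrD; lra.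
Qed.

Lemma h_recr s n : h R s n.+1 = h R s n + (subhalf n.+1 ^+ s)^-1.
Proof. by rewrite /h big_nat_recr. Qed.

Lemma h0 s : h R s 0 = 0.
Proof. by rewrite /h big_geq. Qed.

Lemma h_sub s N d : (d <= N)%N ->
  h R s N - h R s (N - d)
  = \sum_(1 <= l < d.+1) (subhalf (l + (N - d)) ^+ s)^-1.
Proof.
move=> dN; rewrite /h (@big_cat_nat _ _ _ (N - d).+1 1 N.+1) ?ltnS ?leq_subr //=.
rewrite addrAC subrr add0r -{1}[(N - d).+1]add1n big_addn.
by have -> : (N.+1 - (N - d) = d.+1)%N by lia.
Qed.

(** The difference is a sum of d terms, each at most the corresponding one
    among the first d terms. The bound by h_d, uniform in N, is what allows
    dominated convergence for exponent 1, where h_N itself is unbounded. *)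
Lemma h_sub_bounds s N d : (d <= N)%N ->
  0 <= h R s N - h R s (N - d) <= h R s d.
Proof.
move=> dN; rewrite h_sub //; apply/andP; split.
  rewrite big_nat sumr_ge0 // => l /andP[l0 _].
  by rewrite invr_ge0 exprn_ge0 // ltW // subhalf_gt0 // addn_gt0 l0.
apply: ler_sum_nat => l /andP[l0 _].
have hl := subhalf_gt0 l0.
have hl' : 0 < subhalf (l + (N - d)) by rewrite subhalf_gt0 // addn_gt0 l0.
rewrite lef_pV2 ?posrE ?exprn_gt0 //.
rewrite lerXn2r ?nnegrE ?(ltW hl) ?(ltW hl') //.
by rewrite /subhalf lerD2r ler_nat leq_addr.
Qed.

Lemma h_ge0 s n : 0 <= h R s n.
Proof. by have /andP[] := h_sub_bounds s (leqnn n); rewrite subnn h0 subr0. Qed.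

Lemma le_h s m n : (m <= n)%N -> h R s m <= h R s n.
Proof.
move=> mn; have /andP[+ _] := h_sub_bounds s (leq_subr m n).
by rewrite subKn // subr_ge0.
Qed.

Lemma h1_1 : h R 1 1 = 2.
Proof. by rewrite h_recr h0 add0r expr1 /subhalf; field. Qed.

Lemma h1_ge1 n : (0 < n)%N -> 1 <= h R 1 n.
Proof.
move=> n0; apply: le_trans (le_h 1 n0).
by rewrite h1_1; lra.
Qed.

Lemma inv_subhalf_exp_le s n : (0 < n)%N ->
  (subhalf n ^+ s.+1)^-1 <= 2 ^+ s * (subhalf n)^-1.
Proof.
move=> n0; have hn := subhalf_gt0 n0.
rewrite exprSr invfM ler_pM2r ?invr_gt0 // -exprVn lerXn2r ?nnegrE //.
  by rewrite invr_ge0 ltW.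
rewrite invf_ple ?posrE //.
have : 1 <= n%:R :> R by [rewrite ler1n]; rewrite /subhalf; lra.
Qed.

Lemma h_le_h1 s n : h R s.+1 n <= 2 ^+ s * h R 1 n.
Proof.
rewrite mulr_sumr; apply: ler_sum_nat => l /andP[l0 _].
by rewrite expr1; apply: inv_subhalf_exp_le.
Qed.

Definition weight (n : nat) : R := (n%:R * n.+1%:R)^-1.

Lemma weight_gt0 n : (0 < n)%N -> 0 < weight n.
Proof. by move=> n0; rewrite invr_gt0 mulr_gt0 ?ltr0n. Qed.

Lemma inv_nat_exp_le r n : (0 < n)%N ->
  (n%:R ^+ r.+2)^-1 <= 2 * weight n :> R.
Proof.
move=> n0; have n1 : 1 <= n%:R :> R by rewrite ler1n.
have np : 0 < n%:R :> R by lra.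
rewrite /weight -[leRHS]invrK lef_pV2 ?posrE ?invr_gt0 ?exprn_gt0 //; last first.
  by rewrite mulr_gt0 // invr_gt0 mulr_gt0 ?ltr0n.
rewrite invfM invrK; apply: (@le_trans _ _ (n%:R ^+ 2)).
  by rewrite -(natr1 n) expr2; nra.
by rewrite ler_weXn2l.
Qed.

Lemma inv_subhalf_exp_le_weight r n : (0 < n)%N ->
  (subhalf n ^+ r.+2)^-1 <= 2 ^+ r.+3 * weight n.
Proof.
move=> n0; have hn := subhalf_gt0 n0.
rewrite [2 ^+ _]exprSr -mulrA.
apply: le_trans (ler_wpM2l (exprn_ge0 _ _) (inv_nat_exp_le r n0)) => //.
rewrite -[2 ^+ _]invrK -invfM lef_pV2 ?posrE ?exprn_gt0 //; last first.
  by rewrite mulr_gt0 ?invr_gt0 ?exprn_gt0 ?ltr0n.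
rewrite -exprVn -exprMn lerXn2r ?nnegrE ?mulr_ge0 ?invr_ge0 ?ler0n ?(ltW hn) //.
have := le_subhalf n0; lra.
Qed.

(** The bound telescopes: h_N / N - h_(N+1) / (N + 1) is h_N / (N (N + 1)) up
    to a term of order N ^ -2, which the summand 1 / (N + 1) absorbs. *)
Lemma sum_h1_weight_le N :
  \sum_(1 <= n < N.+1) h R 1 n * weight n
  <= 3 - (h R 1 N.+1 + 1) / N.+1%:R.
Proof.
elim: N => [|N IH].
  by rewrite big_geq // h1_1 divr1; lra.
rewrite big_nat_recr //=; apply: (le_trans (lerD IH (lexx _))).
rewrite /weight (h_recr 1 N.+1) expr1.
have := h_ge0 1 N.+1; set H := h R 1 N.+1 => H0.
have x1 : 1 <= N.+1%:R :> R by rewrite ler1n.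
have -> : subhalf N.+2 = N.+1%:R + 1 / 2 by rewrite /subhalf -(natr1 N.+1); lra.
rewrite -(natr1 N.+1); set x := N.+1%:R in x1 *.
rewrite -subr_ge0.
have -> : 3 - (H + (x + 1 / 2)^-1 + 1) / (x + 1)
    - (3 - (H + 1) / x + H * (x * (x + 1))^-1)
    = 1 / 2 / (x * (x + 1) * (x + 1 / 2)).
  by field; rewrite !gt_eqF //; lra.
by rewrite divr_ge0 // ?mulr_ge0 //; lra.
Qed.

(** The common majorant h_n / (n (n + 1)) is summable by [sum_h1_weight_le],
    and up to a constant it dominates every series of the theorem. *)
Lemma cvg_sum_ge1 (K : R) (u : nat -> R) : 0 <= K ->
  (forall n, (0 < n)%N -> 0 <= u n <= K * (h R 1 n * weight n)) ->
  (fun N => \sum_(1 <= n < N.+1) u n) @ \oo --> sum_ge1 u.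
Proof.
move=> K0 uK.
have H : (fun N => \sum_(1 <= n < N) u n) @ \oo --> sum_ge1 u.
  apply: nondecreasing_is_cvgn.
    apply/nondecreasing_seqP => -[|N]; first by rewrite !big_geq.
    by rewrite [leRHS]big_nat_recr //= lerDl; have /andP[] := uK N.+1 isT.
  exists (K * 3) => _ [N _ <-]; apply: le_trans (_ : _ <= K * _) _; last first.
    apply: (ler_wpM2l K0); apply: le_trans (sum_h1_weight_le N) _.
    by rewrite lerBlDr lerDl divr_ge0 // addr_ge0 // h_ge0.
  case: N => [|N].
    by rewrite !big_geq // mulr0.
  rewrite mulr_sumr [leRHS]big_nat_recr //=.
  rewrite -[leLHS]addr0 lerD //; last first.
    by have /andP[u0 uK1] := uK N.+1 isT; apply: le_trans u0 uK1.
  by apply: ler_sum_nat => n /andP[n0 _]; have /andP[] := uK n n0.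
by rewrite -cvg_shiftS in H.
Qed.

(** Tannery's theorem (dominated convergence for series) with limit zero, for
    the majorant of [cvg_sum_ge1]: the tail beyond M is at most the tail of the
    majorant, and the first M terms tend to zero. *)
Lemma tannery0 (K : R) (f : nat -> nat -> R) : 0 <= K ->
  (forall N n, (0 < n <= N)%N -> 0 <= f N n <= K * (h R 1 n * weight n)) ->
  (forall n, (0 < n)%N -> f ^~ n @ \oo --> (0 : R)) ->
  (fun N => \sum_(1 <= n < N.+1) f N n) @ \oo --> (0 : R).
Proof.
move=> K0 fK f0; pose g n := h R 1 n * weight n.
have g0 n : (0 < n)%N -> 0 <= g n.
  by move=> n0; rewrite mulr_ge0 ?h_ge0 // ltW ?weight_gt0.
have cg : (fun N => \sum_(1 <= n < N.+1) g n) @ \oo --> sum_ge1 g.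
  by apply: (@cvg_sum_ge1 1) => // n n0; rewrite mul1r g0 //=.
pose G N : R := K * (sum_ge1 g - \sum_(1 <= n < N.+1) g n).
have G0 : G @ \oo --> (0 : R).
  rewrite -(mulr0 K) -(subrr (sum_ge1 g)).
  by apply: cvgMl_tmp; apply: cvgB => //; apply: cvg_cst.
have leg N : \sum_(1 <= n < N.+1) g n <= sum_ge1 g.
  rewrite -(cvg_lim _ cg) //; apply: nondecreasing_cvgn_le; last exact: cvgP cg.
  by apply/nondecreasing_seqP => n; rewrite [leRHS]big_nat_recr //= lerDl g0.
have split M N : (M <= N)%N ->
    \sum_(1 <= n < N.+1) f N n <= \sum_(1 <= n < M.+1) f N n + G M.
  move=> MN; rewrite (@big_cat_nat _ _ _ M.+1) //= lerD2l.
  have -> : G M = K * (sum_ge1 g - \sum_(1 <= n < N.+1) g n)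
      + K * \sum_(M.+1 <= n < N.+1) g n.
    by rewrite /G [X in _ = _ * (_ - X) + _](@big_cat_nat _ _ _ M.+1) //=; ring.
  rewrite -[leLHS]add0r lerD ?mulr_ge0 ?subr_ge0 // mulr_sumr.
  apply: ler_sum_nat => n /andP[Mn nN].
  by have /andP[] := fK N n (introT andP (conj (leq_trans (ltn0Sn _) Mn) nN)).
have fin M : (fun N => \sum_(1 <= n < M.+1) f N n) @ \oo --> (0 : R).
  elim: M => [|M IH].
    by under eq_fun do rewrite big_geq //; apply: cvg_cst.
  under eq_fun do rewrite big_nat_recr //=.
  by have E := cvgD IH (f0 M.+1 isT); rewrite addr0 in E; exact: E.
apply/cvgr0Pnorm_lt => e e0.
have e2 : 0 < e / 2 by rewrite divr_gt0.
have /cvgr0Pnorm_lt/(_ _ e2)[M _ HM] := G0.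
have /cvgr0Pnorm_lt/(_ _ e2) fM := fin M.
near=> N.
have MN : (M <= N)%N by near: N; exact: nbhs_infty_ge.
rewrite ger0_norm; last first.
  by rewrite big_nat sumr_ge0 // => n nN; have /andP[] := fK N n nN.
apply: le_lt_trans (split M N MN) _.
rewrite [e in _ < e]splitr ltrD //.
  by apply: le_lt_trans (ler_norm _) _; near: N.
by apply: le_lt_trans (ler_norm _) _; apply: HM => /=.
Unshelve. all: by end_near.
Qed.

Lemma cvg_h_sub s d :
  (fun N => h R s.+1 N - h R s.+1 (N - d)) @ \oo --> (0 : R).
Proof.
have step : (fun N => h R s.+1 N - h R s.+1 N.-1) @ \oo --> (0 : R).
  rewrite -cvg_shiftS /=.
  apply: (@squeeze_cvgr _ _ _ _ (fun=> 0) (fun N => 2 ^+ s.+1 * harmonic N)).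
  - near=> N; rewrite h_recr addrAC subrr add0r /=; apply/andP; split.
      by rewrite invr_ge0 exprn_ge0 // ltW ?subhalf_gt0.
    apply: le_trans (inv_subhalf_exp_le s (ltn0Sn N)) _.
    rewrite exprSr -mulrA ler_pM2l ?exprn_gt0 //.
    rewrite invf_ple ?posrE ?mulr_gt0 ?invr_gt0 ?subhalf_gt0 ?ltr0n //.
    rewrite invfM invrK; have := le_subhalf (ltn0Sn N); lra.
  - exact: cvg_cst.
  - by rewrite -(mulr0 (2 ^+ s.+1)); apply: cvgMl_tmp; apply: cvg_harmonic.
elim: d => [|d IH].
  by under eq_fun do rewrite subn0 subrr; apply: cvg_cst.
have -> : (fun N => h R s.+1 N - h R s.+1 (N - d.+1))
    = (fun N => (h R s.+1 N - h R s.+1 (N - d))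
         + (h R s.+1 (N - d) - h R s.+1 (N - d).-1)).
  by apply/funext => N; rewrite subnS; ring.
rewrite -(addr0 0); apply: cvgD => //.
by move: step; rewrite -(cvg_centern d).
Unshelve. all: by end_near.
Qed.

Lemma cvg_h s : (2 <= s)%N -> h R s @ \oo --> t_tilde R s.
Proof.
case: s => [|[|s]] // _.
apply: (@cvg_sum_ge1 (2 ^+ s.+3)) => [|n n0]; first exact: exprn_ge0.
rewrite invr_ge0 exprn_ge0 ?(ltW (subhalf_gt0 n0)) //=.
apply: le_trans (inv_subhalf_exp_le_weight s n0) _.
rewrite ler_pM2l ?exprn_gt0 // -[leLHS]mul1r ler_pM2r ?weight_gt0 //.
exact: h1_ge1.
Qed.

Definition zeta_sum (s N : nat) : R := \sum_(1 <= n < N.+1) (n%:R ^+ s)^-1.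

Lemma cvg_zeta_sum s : (2 <= s)%N -> zeta_sum s @ \oo --> zeta R s.
Proof.
case: s => [|[|s]] // _; apply: (@cvg_sum_ge1 2) => // n n0.
rewrite invr_ge0 exprn_ge0 //=; apply: le_trans (inv_nat_exp_le s n0) _.
rewrite ler_pM2l // -[leLHS]mul1r ler_pM2r ?weight_gt0 //.
exact: h1_ge1.
Qed.

(** Among 1, ..., 2N the even numbers are 2n and the odd ones are 2 (n - 1/2).
    *)
Lemma zeta_sum_double s N :
  2 ^+ s * zeta_sum s (2 * N) = zeta_sum s N + h R s N.
Proof.
elim: N => [|N IH]; first by rewrite /zeta_sum h0 !big_geq // mulr0 addr0.
have -> : (2 * N.+1 = (2 * N).+2)%N by lia.
rewrite /zeta_sum 2?big_nat_recr //= -/(zeta_sum s _).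
rewrite [in RHS]big_nat_recr //= -/(zeta_sum s _).
rewrite h_recr addrACA -IH !mulrDr -!addrA; congr (_ + _).
have E (x : R) : 2 ^+ s * (x ^+ s)^-1 = ((x / 2) ^+ s)^-1.
  by rewrite exprMn invfM exprVn invrK mulrC.
rewrite addrC !E.
congr ((_ ^+ s)^-1 + (_ ^+ s)^-1).
  have -> : (2 * N).+2 = (2 * N.+1)%N by lia.
  by rewrite natrM mulrAC divff ?mul1r.
by rewrite /subhalf -!natr1 natrM; field.
Qed.

(** 1 / (n + 1) <= ln (n + 1) - ln n <= 1 / n, summed from N to 2N. *)
Lemma zeta_sum1_double_bounds N :
  (0 < N)%N ->
  ln 2 - N%:R^-1 <= zeta_sum 1 (2 * N) - zeta_sum 1 N <= ln (2 : R).
Proof.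
move=> N0.
have step n : (0 < n)%N ->
    n.+1%:R^-1 <= ln (n.+1%:R : R) - ln n%:R <= n%:R^-1.
  move=> n0; have np : 0 < n%:R :> R by rewrite ltr0n.
  have nSp : 0 < n.+1%:R :> R by rewrite ltr0n.
  apply/andP; split.
    have := @le_ln1Dx R (- n.+1%:R^-1).
    have -> : 1 + - n.+1%:R^-1 = n%:R / n.+1%:R :> R.
      by rewrite -natr1; field; rewrite natr1 gt_eqF.
    rewrite ln_div ?posrE //.
    rewrite ltrN2 invf_lt1 // ltr1n => /(_ n0).
    by rewrite lerBlDr -lerBlDl opprK addrC lerBrDr addrC.
  have := @le_ln1Dx R n%:R^-1.
  have -> : 1 + n%:R^-1 = n.+1%:R / n%:R :> R.
    by rewrite -natr1; field; rewrite gt_eqF.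
  rewrite ln_div ?posrE //; apply.
  by apply: lt_trans (_ : 0 < _); rewrite ?invr_gt0 // ltrN10.
have ln2 : ln (2 : R) = ln (2 * N)%:R - ln N%:R.
  by rewrite natrM lnM ?posrE ?ltr0n // addrK.
have H k : zeta_sum 1 (N + k) - zeta_sum 1 N <= ln (N + k)%:R - ln N%:R
    <= zeta_sum 1 (N + k) - zeta_sum 1 N + N%:R^-1 - (N + k)%:R^-1.
  elim: k => [|k /andP[IH1 IH2]].
    by rewrite addn0 !subrr add0r subrr lexx.
  have -> : zeta_sum 1 (N + k.+1) = zeta_sum 1 (N + k) + (N + k.+1)%:R^-1.
    by rewrite addnS /zeta_sum big_nat_recr //= expr1.
  have /andP[] := step (N + k)%N (leq_trans N0 (leq_addr _ _)).
  by rewrite -addnS => H1 H2; apply/andP; split; lra.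
have := H N; rewrite addnn -mul2n ln2 => /andP[-> H2] /=; rewrite andbT.
have : 0 <= (2 * N)%:R^-1 :> R by rewrite invr_ge0.
lra.
Qed.

(** The origin of the convention zeta(1) = - 2 ln 2: by [zeta_sum_double] with
    s = 1 the difference is 2 (1 / (N + 1) + ... + 1 / (2 N)). *)
Lemma cvg_h1_sub_zeta_sum1 :
  (fun N => h R 1 N - zeta_sum 1 N) @ \oo --> 2 * ln (2 : R).
Proof.
have -> : (fun N => h R 1 N - zeta_sum 1 N)
    = (fun N => 2 * (zeta_sum 1 (2 * N) - zeta_sum 1 N)).
  by apply/funext => N; have := zeta_sum_double 1 N; rewrite expr1; lra.
apply: cvgMl_tmp; rewrite -cvg_shiftS /=.
apply: (@squeeze_cvgr _ _ _ _ (fun N => ln 2 - harmonic N) (fun=> ln 2)).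
- by near=> N; apply: zeta_sum1_double_bounds.
- have E := cvgB (@cvg_cst _ (ln (2 : R)) _ \oo _) (@cvg_harmonic R).
  by rewrite subr0 in E; exact: E.
- exact: cvg_cst.
Unshelve. all: by end_near.
Qed.

Lemma t_tilde_zeta s : (2 <= s)%N -> t_tilde R s = (2 ^+ s - 1) * zeta R s.
Proof.
move=> s2; apply/esym; apply: (cvg_unique _ _ (cvg_h s2)) => //.
have -> : h R s = (fun N => 2 ^+ s * zeta_sum s (2 * N) - zeta_sum s N).
  by apply/funext => N; rewrite zeta_sum_double; ring.
rewrite mulrBl mul1r; apply: cvgB; last exact: cvg_zeta_sum.
by apply: cvgMl_tmp; apply: (cvg_comp _ _ (@cvg_mulnl 2 isT) (cvg_zeta_sum s2)).
Qed.
End Analysis.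

(** * Passing to the limit in the residue identity *)

Section Assembly.
Variable R : realType.

(** The partial sums h_(N - d n) are replaced by h_N at the cost of an error
    that vanishes by [tannery0]. For exponent at least 2, h_N tends to t~; for
    exponent 1 the two occurrences of h_N cancel, which is the convention t~(1)
    = 0. *)
Lemma cvg_weighted_sum (K : R) (w : nat -> R) (d : nat -> nat) s :
  0 <= K ->
  (forall n, (0 < n)%N -> 0 <= w n <= K * weight R n) ->
  (forall n, (d n <= n)%N) ->
  (fun N => \sum_(1 <= n < N.+1)
      (h R s.+1 (d n) + (-1) ^+ s.+1 * h R s.+1 (N - d n)
        + (s == 0%N)%:R * h R s.+1 N) * w n) @ \oo -->
    sum_ge1 (fun n => h R s.+1 (d n) * w n)
    + (-1) ^+ s.+1 * t_conv R s.+1 * sum_ge1 w.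
Proof.
move=> K0 wK dn.
have K20 : 0 <= 2 ^+ s * K by rewrite mulr_ge0 ?exprn_ge0.
have cw : (fun N => \sum_(1 <= n < N.+1) w n) @ \oo --> sum_ge1 w.
  apply: (@cvg_sum_ge1 _ K) => // n n0; have /andP[-> wn] := wK n n0.
  apply: (le_trans wn); apply: (ler_wpM2l K0).
  by rewrite -[leLHS]mul1r ler_pM2r ?weight_gt0 // h1_ge1.
have hw n x : (0 < n)%N -> 0 <= x <= h R s.+1 (d n) ->
    0 <= x * w n <= (2 ^+ s * K) * (h R 1 n * weight R n).
  move=> n0 /andP[x0 xh]; have /andP[w0 wn] := wK n n0.
  rewrite mulr_ge0 //= mulrACA ler_pM //.
  exact: le_trans xh (le_trans (le_h _ _ (dn n)) (h_le_h1 _ _ _)).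
have c1 : (fun N => \sum_(1 <= n < N.+1) h R s.+1 (d n) * w n) @ \oo
    --> sum_ge1 (fun n => h R s.+1 (d n) * w n).
  by apply: (@cvg_sum_ge1 _ (2 ^+ s * K)) => // n n0; rewrite hw // h_ge0 lexx.
have c3 : (fun N => \sum_(1 <= n < N.+1)
    (h R s.+1 N - h R s.+1 (N - d n)) * w n) @ \oo --> (0 : R).
  apply: (@tannery0 _ (2 ^+ s * K)) => // [N n /andP[n0 nN]|n n0].
    by rewrite hw // h_sub_bounds // (leq_trans (dn n)).
  rewrite -[X in _ --> X](mul0r (w n)); apply: cvgMr_tmp; exact: cvg_h_sub.
have c2 : (fun N => ((-1) ^+ s.+1 + (s == 0%N)%:R) * h R s.+1 N) @ \oo
    --> ((-1) ^+ s.+1 * t_conv R s.+1).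
  case: s {c1 c3 hw K20} => [|s].
    rewrite expr1 /t_conv /= mulr0 addNr.
    by under eq_fun do rewrite mul0r; apply: cvg_cst.
  by rewrite addr0; apply: cvgMl_tmp; apply: cvg_h.
have -> : (fun N => \sum_(1 <= n < N.+1)
      (h R s.+1 (d n) + (-1) ^+ s.+1 * h R s.+1 (N - d n)
        + (s == 0%N)%:R * h R s.+1 N) * w n)
   = (fun N => \sum_(1 <= n < N.+1) h R s.+1 (d n) * w n
       + ((-1) ^+ s.+1 + (s == 0%N)%:R) * h R s.+1 N * \sum_(1 <= n < N.+1) w n
       - (-1) ^+ s.+1 * \sum_(1 <= n < N.+1)
           (h R s.+1 N - h R s.+1 (N - d n)) * w n).
  apply/funext => N; move: (h R s.+1 N) (s == 0%N)%:R => hN e.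
  rewrite !mulr_sumr -big_split -sumrB /=.
  by apply: eq_bigr => n _; ring.
have E := cvgB (cvgD c1 (cvgM c2 cw)) (cvgMl_tmp (a := (-1) ^+ s.+1) c3).
by rewrite mulr0 subr0 in E; exact: E.
Qed.

Lemma sum_antidiagE n (F : nat -> nat -> R) :
  sum_antidiag n F = \sum_(i < n.+1) F i (n - i)%N.
Proof.
rewrite /sum_antidiag.
rewrite -(pair_big_dep xpredT (fun i j : 'I_n.+1 => (i + j)%N == n)
  (fun i j => F i j)) /=.
apply: eq_bigr => i _; rewrite (big_pred1 (inord (n - i))) /= => [|j].
  by rewrite inordK // ltnS leq_subr.
rewrite inE -val_eqE /= inordK ?ltnS ?leq_subr //.
by have := ltn_ord i; have := ltn_ord j; lia.
Qed.

Lemma sum_antidiagD n (F G : nat -> nat -> R) :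
  sum_antidiag n (fun i j => F i j + G i j)
  = sum_antidiag n F + sum_antidiag n G.
Proof. by rewrite /sum_antidiag big_split. Qed.

Lemma sum_antidiagZ n c (F : nat -> nat -> R) :
  sum_antidiag n (fun i j => c * F i j) = c * sum_antidiag n F.
Proof. by rewrite /sum_antidiag mulr_sumr. Qed.

(** The constant added to a truncated sum of poles of order m + 1, nonzero for
    simple poles only: sum over k <= N of 1 / (s - k) diverges with N, but
    adding h_N, the sum of the 1 / (k - 1/2), makes it converge to a function
    that vanishes at s = 1/2. Likewise for the poles l - 1/2, where the limit
    vanishes at s = 0. *)
Definition regulariser (m N : nat) : R := (m == 0%N)%:R * h R 1 N.

(** The sum of the residues at the points x_l, both for the half-integers with
    the integers as other poles and for the converse. The two cases differ only
    in the number d l of other poles lying to the left of x_l. *)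
Lemma cvg_pole_sum (x y : nat -> R) (d : nat -> nat) m p n :
  (forall s N l, (0 < l <= N)%N ->
     \sum_(1 <= k < N.+1) ((x l - y k) ^+ s)^-1
     = h R s (d l) + (-1) ^+ s * h R s (N - d l)) ->
  (forall r l, (0 < l)%N ->
     0 <= (x l ^+ r.+2)^-1 <= 2 ^+ r.+3 * weight R l) ->
  (forall l, (d l <= l)%N) ->
  (fun N => \sum_(1 <= l < N.+1) cauchy_prod p
      (fun i => \sum_(1 <= k < N.+1) pole_coef (x l - y k) m.+1 i
         + regulariser m N * kronecker0 R i)
      (pole_coef (x l) n.+2)) @ \oo -->
  sum_antidiag p (fun i j =>
     'C(m.+1 + i - 1, i)%:R * 'C(n.+2 + j - 1, j)%:R
       * sum_ge1 (fun l => h R (m.+1 + i) (d l) / x l ^+ (n.+2 + j)))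
  + sum_antidiag p (fun i j =>
     'C(m.+1 + i - 1, i)%:R * 'C(n.+2 + j - 1, j)%:R
       * (-1) ^+ (m.+1 + i) * t_conv R (m.+1 + i)
       * sum_ge1 (fun l => (x l ^+ (n.+2 + j))^-1)).
Proof.
move=> xy xw dl; rewrite -sum_antidiagD sum_antidiagE.
have -> : (fun N => \sum_(1 <= l < N.+1) cauchy_prod p
      (fun i => \sum_(1 <= k < N.+1) pole_coef (x l - y k) m.+1 i
         + regulariser m N * kronecker0 R i)
      (pole_coef (x l) n.+2))
  = (fun N => \sum_(i < p.+1)
      'C(m.+1 + i - 1, i)%:R * 'C(n.+2 + (p - i) - 1, p - i)%:R *
      \sum_(1 <= l < N.+1)
        (h R (m + i).+1 (d l) + (-1) ^+ (m + i).+1 * h R (m + i).+1 (N - d l)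
          + ((m + i)%N == 0%N)%:R * h R (m + i).+1 N)
        * (x l ^+ (n.+2 + (p - i)))^-1).
  apply/funext => N; rewrite /cauchy_prod exchange_big /=.
  apply: eq_bigr => i _; rewrite mulr_sumr big_nat [RHS]big_nat.
  apply: eq_bigr => l lN; rewrite /pole_coef -mulr_sumr xy // addSn.
  rewrite /regulariser /kronecker0 addn_eq0.
  (* The regulariser enters only the coefficient of degree 0 of a simple pole, and
     there the binomial coefficient is 1. *)
  case: eqP => [->|_]; case: eqP => [->|_] /=; rewrite ?addn0 ?bin0; ring.
apply: (@cvg_big _ _ +%R 0 _ add_continuous) => i _.
have factor (a u sg t v : R) : a * u + a * sg * t * v = a * (u + sg * t * v).
  by ring.
rewrite factor; apply: cvgMl_tmp; rewrite !addSn.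
apply: (@cvg_weighted_sum (2 ^+ (n + (p - i)).+3)) => [|l l0|//].
  exact: exprn_ge0.
exact: xw.
Qed.

(** The factor (-1) ^ (m + 1) turns powers of k - s into powers of s - k, so
    that this is the Taylor expansion at 0 of the regularised sum over the
    integers. *)
Lemma cvg_pole_nat m i :
  (fun N => (-1) ^+ m.+1 * (\sum_(1 <= k < N.+1) pole_coef k%:R m.+1 i)
            + regulariser m N * kronecker0 R i) @ \oo -->
  (-1) ^+ m.+1 * ('C(m.+1 + i - 1, i)%:R * zeta_conv R (m.+1 + i)).
Proof.
have E N : \sum_(1 <= k < N.+1) pole_coef k%:R m.+1 i
  = 'C(m.+1 + i - 1, i)%:R * zeta_sum R (m.+1 + i) N by rewrite mulr_sumr.
under eq_fun do
  rewrite E /regulariser /kronecker0 mulrAC -natrM mulnb -addn_eq0.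
rewrite /zeta_conv; case: eqP => [mi|/eqP mi].
  have [-> ->] : m = 0%N /\ i = 0%N by lia.
  have -> : (fun N => (-1) ^+ 1 * ('C(1 + 0 - 1, 0)%:R * zeta_sum R (1 + 0) N)
      + ((0 + 0)%N == 0%N)%:R * h R 1 N) = (fun N => h R 1 N - zeta_sum R 1 N).
    by apply/funext => N; rewrite bin0 !addn0 eqxx expr1 !mul1r mulN1r addrC.
  have -> : (-1) ^+ 1 * ('C(1 + 0 - 1, 0)%:R * (-2 * ln 2)) = 2 * ln 2 :> R.
    by rewrite bin0; ring.
  exact: cvg_h1_sub_zeta_sum1.
have /negPf mi0 : (m + i)%N != 0%N by lia.
under eq_fun do rewrite mi0 mul0r addr0.
by do 2!apply: cvgMl_tmp; apply: cvg_zeta_sum; lia.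
Qed.

Lemma cvg_pole_subhalf m i :
  (fun N => (-1) ^+ m.+1 * (\sum_(1 <= k < N.+1) pole_coef (subhalf R k) m.+1 i)
            + regulariser m N * kronecker0 R i) @ \oo -->
  (-1) ^+ m.+1 * ('C(m.+1 + i - 1, i)%:R * t_conv R (m.+1 + i)).
Proof.
have E N : \sum_(1 <= k < N.+1) pole_coef (subhalf R k) m.+1 i
  = 'C(m.+1 + i - 1, i)%:R * h R (m.+1 + i) N by rewrite mulr_sumr.
under eq_fun do
  rewrite E /regulariser /kronecker0 mulrAC -natrM mulnb -addn_eq0.
rewrite /t_conv; case: eqP => [mi|/eqP mi].
  have [-> ->] : m = 0%N /\ i = 0%N by lia.
  under eq_fun do rewrite bin0 !addn0 eqxx expr1 !mul1r mulN1r addNr.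
  by rewrite !mulr0; apply: cvg_cst.
have /negPf mi0 : (m + i)%N != 0%N by lia.
under eq_fun do rewrite mi0 mul0r addr0.
by do 2!apply: cvgMl_tmp; apply: cvg_h; lia.
Qed.

(** The limit N -> oo of [residue_sum_family] for the poles 1, ..., N and 1/2,
    ..., N - 1/2. *)
Lemma residue_limit m p n :
  (-1) ^+ p * (sum_antidiag p (fun i j =>
       'C(m.+1 + i - 1, i)%:R * 'C(n.+2 + j - 1, j)%:R
         * T R (m.+1 + i) (n.+2 + j))
     + sum_antidiag p (fun i j =>
       'C(m.+1 + i - 1, i)%:R * 'C(n.+2 + j - 1, j)%:R
         * (-1) ^+ (m.+1 + i) * t_conv R (m.+1 + i) * t_conv R (n.+2 + j)))
  + (-1) ^+ m * (sum_antidiag m (fun i j =>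
       'C(p.+1 + i - 1, i)%:R * 'C(n.+2 + j - 1, j)%:R
         * S_tilde R (p.+1 + i) (n.+2 + j))
     + sum_antidiag m (fun i j =>
       'C(p.+1 + i - 1, i)%:R * 'C(n.+2 + j - 1, j)%:R
         * (-1) ^+ (p.+1 + i) * t_conv R (p.+1 + i) * zeta_conv R (n.+2 + j)))
  + (-1) ^+ m.+1 * (-1) ^+ p.+1 * sum_antidiag n.+1 (fun i j =>
       'C(m.+1 + i - 1, i)%:R * 'C(p.+1 + j - 1, j)%:R
         * zeta_conv R (m.+1 + i) * t_conv R (p.+1 + j))
  = 0.
Proof.
pose E (N : nat) : R :=
  (-1) ^+ p * (\sum_(1 <= l < N.+1) cauchy_prod p
     (fun i => \sum_(1 <= k < N.+1) pole_coef (subhalf R l - k%:R) m.+1 i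
               + regulariser m N * kronecker0 R i)
     (pole_coef (subhalf R l) n.+2))
  + (-1) ^+ m * (\sum_(1 <= k < N.+1) cauchy_prod m
     (fun i => \sum_(1 <= l < N.+1) pole_coef (k%:R - subhalf R l) p.+1 i
               + regulariser p N * kronecker0 R i) (pole_coef k%:R n.+2))
  + cauchy_prod n.+1
      (fun i => (-1) ^+ m.+1 * (\sum_(1 <= k < N.+1) pole_coef k%:R m.+1 i)
                + regulariser m N * kronecker0 R i)
      (fun j => (-1) ^+ p.+1
                * (\sum_(1 <= l < N.+1) pole_coef (subhalf R l) p.+1 j)
                + regulariser p N * kronecker0 R j).
have E0 : E = fun=> 0.
  apply/funext => N; apply: residue_sum_family => [k|l|k l].
  - by rewrite mem_index_iota => /andP[k0 _]; rewrite pnatr_eq0 -lt0n.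
  - by rewrite subhalf_neq0.
  - by rewrite natr_neq_subhalf.
have E0' : E @ \oo --> (0 : R) by rewrite E0; apply: cvg_cst.
apply: (cvg_unique _ _ E0') => //.
apply: cvgD; [apply: cvgD; apply: cvgMl_tmp|].
- apply: (@cvg_pole_sum (@subhalf R) (fun k => k%:R) (subn^~ 1%N))
    => [s N l /andP[l0 lN]|r l l0|l]; last exact: leq_subr.
  + rewrite -sum_inv_nat_sub_subhalf; last first.
      by apply: leq_trans lN; apply: leq_subr.
    apply: eq_bigr => k _; congr ((_ ^+ s)^-1).
    by rewrite /subhalf natrB //; field.
  + rewrite inv_subhalf_exp_le_weight // invr_ge0 exprn_ge0 //.
    by rewrite ltW // subhalf_gt0.
- apply: (@cvg_pole_sum (fun k => k%:R) (@subhalf R) id)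
    => [s N l /andP[l0 lN]|r l l0|l] //.
  + exact: sum_inv_nat_sub_subhalf.
  + rewrite invr_ge0 exprn_ge0 //=; apply: le_trans (inv_nat_exp_le R r l0) _.
    rewrite ler_pM2r ?weight_gt0 // exprS -[leLHS]mulr1 ler_pM2l //.
    by rewrite exprn_ege1 // ler1n.
- rewrite -sum_antidiagZ sum_antidiagE.
  apply: (@cvg_big _ _ +%R 0 _ add_continuous) => i _.
  have factor (s s' a b z t : R) :
      s * s' * (a * b * z * t) = s * (a * z) * (s' * (b * t)) by ring.
  rewrite factor.
  by apply: cvgM; [apply: cvg_pole_nat|apply: cvg_pole_subhalf].
Qed.

(** * The algebra generated by ln 2 and the zeta values *)

Lemma rat_subalgebra_Q_ln2_zeta : rat_subalgebra (@Q_ln2_zeta R).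
Proof.
split=> [A [[]] //|a x y Ax Ay A AA|x y Ax Ay A AA]; case: (AA) => -[_ Al Am] _.
  by apply: Al; [apply: Ax|apply: Ay].
by apply: Am; [apply: Ax|apply: Ay].
Qed.

Lemma Q_ln2_zetaM (x y : R) :
  Q_ln2_zeta x -> Q_ln2_zeta y -> Q_ln2_zeta (x * y).
Proof. by have [_ _] := rat_subalgebra_Q_ln2_zeta; apply. Qed.

Lemma Q_ln2_zetaD (x y : R) :
  Q_ln2_zeta x -> Q_ln2_zeta y -> Q_ln2_zeta (x + y).
Proof.
have [_ Al _] := rat_subalgebra_Q_ln2_zeta => Ax Ay.
by have := Al 1 x y Ax Ay; rewrite rmorph1 mul1r.
Qed.

Lemma Q_ln2_zeta_rat (a : rat) : Q_ln2_zeta (ratr a : R).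
Proof.
have [A1 Al _] := rat_subalgebra_Q_ln2_zeta.
have A0 : Q_ln2_zeta (0 : R).
  by have := Al (-1) 1 1 A1 A1; rewrite rmorphN1 mulr1 addNr.
by have := Al a 1 0 A1 A0; rewrite mulr1 addr0.
Qed.

Lemma Q_ln2_zeta_nat (n : nat) : Q_ln2_zeta (n%:R : R).
Proof. by rewrite -ratr_nat; apply: Q_ln2_zeta_rat. Qed.

Lemma Q_ln2_zeta_sign n : Q_ln2_zeta ((-1) ^+ n : R).
Proof.
have -> : (-1) ^+ n = ratr ((-1) ^+ n) :> R by rewrite rmorphXn rmorphN1.
exact: Q_ln2_zeta_rat.
Qed.

Lemma Q_ln2_zeta_zeta_conv s : (0 < s)%N -> Q_ln2_zeta (zeta_conv R s).
Proof.
move=> s0; rewrite /zeta_conv; case: eqP => [_|/eqP s1].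
  apply: Q_ln2_zetaM.
    by rewrite -[2]ratr_nat -rmorphN; apply: Q_ln2_zeta_rat.
  by apply: sub_gen_smallest; left.
by apply: sub_gen_smallest; right; exists s => //=; lia.
Qed.

Lemma Q_ln2_zeta_t_conv s : (0 < s)%N -> Q_ln2_zeta (t_conv R s).
Proof.
move=> s0; rewrite /t_conv; case: eqP => [_|/eqP s1].
  exact: (Q_ln2_zeta_nat 0).
have s2 : (2 <= s)%N by lia.
rewrite t_tilde_zeta //; apply: Q_ln2_zetaM.
  rewrite -natrX -[1]/(1%:R) -natrB ?expn_gt0 //; exact: Q_ln2_zeta_nat.
by have := Q_ln2_zeta_zeta_conv s0; rewrite /zeta_conv (negPf s1).
Qed.

Lemma Q_ln2_zeta_sum_antidiag n (F : nat -> nat -> R) :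
  (forall i j, Q_ln2_zeta (F i j)) -> Q_ln2_zeta (sum_antidiag n F).
Proof.
move=> HF; apply: big_rec => [|ij x _]; first exact: (Q_ln2_zeta_nat 0).
exact: Q_ln2_zetaD.
Qed.

End Assembly.

Theorem theorem3p1 (R : realType) (m p q : nat)
    (hm : (1 <= m)%N) (hp : (1 <= p)%N) (hq : (2 <= q)%N) :
  let X : R :=
    (-1) ^+ (m - 1) *
      sum_antidiag (p - 1) (fun i j =>
        'C(m + i - 1, i)%:R * 'C(q + j - 1, j)%:R * T R (m + i) (q + j))
    + (-1) ^+ (p - 1) *
      sum_antidiag (m - 1) (fun i j =>
        'C(p + i - 1, i)%:R * 'C(q + j - 1, j)%:R
          * S_tilde R (p + i) (q + j)) in
  Q_ln2_zeta X /\
  X =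
    (-1) ^+ m *
      sum_antidiag (p - 1) (fun i j =>
        'C(m + i - 1, i)%:R * 'C(q + j - 1, j)%:R
          * (-1) ^+ (m + i) * t_conv R (m + i) * t_conv R (q + j))
    + (-1) ^+ p *
      sum_antidiag (m - 1) (fun i j =>
        'C(p + i - 1, i)%:R * 'C(q + j - 1, j)%:R
          * (-1) ^+ (p + i) * t_conv R (p + i) * zeta_conv R (q + j))
    - sum_antidiag (q - 1) (fun i j =>
        'C(m + i - 1, i)%:R * 'C(p + j - 1, j)%:R
          * zeta_conv R (m + i) * t_conv R (p + j)).
Proof.
move=> X; set Y := (RHS in _ /\ _ = RHS).
have XY : X = Y.
  rewrite {}/X {}/Y.
  case: m p q hm hp hq => [|m] [|p] [|[|n]] // _ _ _.
  rewrite !subSS !subn0; have := residue_limit R m p n.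
  move: (sum_antidiag _ _) (sum_antidiag _ _) (sum_antidiag _ _)
        (sum_antidiag _ _) (sum_antidiag _ _) => A1 A2 B1 B2 C.
  rewrite !exprS -(signr_odd _ m) -(signr_odd _ p).
  (* Multiplying by (-1) ^ (m + p) turns the residue identity into the claim. *)
  by case: (odd m); case: (odd p); rewrite ?expr0 ?expr1; lra.
(* Subtraction is written as adding a multiple of (-1) ^+ 1, to use closure under
   sums, products and signs only. *)
split=> //; rewrite {}XY {X}/Y -[X in _ - X]mul1r -mulNr -[-1](expr1 (-1)).
by repeat first
  [ apply: Q_ln2_zetaD | apply: Q_ln2_zeta_sum_antidiag => i j
  | apply: Q_ln2_zeta_sign | apply: Q_ln2_zeta_nat
  | apply: Q_ln2_zeta_t_conv; lia | apply: Q_ln2_zeta_zeta_conv; lia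
  | apply: Q_ln2_zetaM ].
Qed.
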